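(* Let $G$ be a finite abelian group, a (finite) dihedral group, a symmetric group $S_n$, or an alternating group $A_n$. Then the unoriented Bogomolov multiplier $B_0(G;\mathbb{Z}_2)$ is trivial.
   Context: Unoriented Schur multiplier. Let $G$ be a group and $S(G)=\langle x^2:x\in G\rangle$ the subgroup generated by squares. Put $[x,y]=xyx^{-1}y^{-1}$, $\{x,y\}=xyx^{-1}y$, $y^x=xyx^{-1}$. Let $(G,G)$ be the free group on the symbols $\langle x,y\rangle$, $(x,y)$ (for $x,y\in G$) and $(z)$ (for $z\in G$). On symbols, $\langle y,z\rangle^x:=\langle y^x,z^x\rangle$, $(y,z)^x:=(y^x,z^x)$, $(z)^x:=(z^x)$. Let $(G,G)\to S(G)$ be the homomorphism with $\langle x,y\rangle\mapsto[x,y]$, $(x,y)\mapsto\{x,y\}$, $(z)\mapsto z^2$, and let $K'$ be its kernel. Let $N'$ be the normal subgroup of $(G,G)$ generated by the following relations ($u\sim v$ meaning $uv^{-1}\in N'$), for all elements of $G$ and all $i,j\in\mathbb{Z}$: (1) $(x^i)(x^j)\sim(x^{i+j})$; (2) $(x,xy)\sim(x)(y)$; (3) $\langle x,y\rangle\sim(x)(x^{-1}y)(y^{-1})$; (4) $\langle xy,z\rangle\sim(y,z)^x(x,z^{-1})$; (5) $\langle y,z\rangle^x\sim\langle x,[y,z]\rangle\langle y,z\rangle$; (6) $(y,z)^x\sim\langle x,\{y,z\}\rangle(y,z)$; (7) $(y^x,z^x)^{-1}\sim(x,\{y,z\}^{-1})(y,z)$; (8) $(z)\langle x,y\rangle\sim\langle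 y,x\rangle^z(z[x,y])$; (9) $(b)\langle a_0,b_0\rangle\sim\langle a_0,b_0\rangle^{b^2}(b)$; (10) $\langle a_0,b_0\rangle(a)\sim(a)\langle a_0,b_0\rangle^{a^{-2}}$. The unoriented Schur multiplier is $\mathcal{M}(G;\mathbb{Z}_2):=K'/N'$. Unoriented Bogomolov multiplier. For a finite group $G$, $B_0(G;\mathbb{Z}_2)$ is the quotient of $\mathcal{M}(G;\mathbb{Z}_2)$ by the subgroup generated by the classes of all $\langle x,y\rangle$ with $[x,y]=1$ (torus classes), all $(x',y')$ with $\{x',y'\}=1$ (Klein bottle classes), and all $(z)$ with $z^2=1$ (projective plane classes). *)

(* Defs.v *)
From HB Require Import structures.
From mathcomp Require Import all_boot all_algebra.
From mathcomp Require Import boolp classical_sets.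

Set Implicit Arguments.
Unset Strict Implicit.
Unset Printing Implicit Defensive.

Local Open Scope quotient_scope.
Local Open Scope classical_set_scope.
Local Open Scope group_scope.

Section FreeGroup.
Variable T : choiceType.

(* The letter (b, t) stands for t if b = true and for t^-1 if b = false.      *)
Definition letter := (bool * T)%type.
Definition letterV (l : letter) : letter := (~~ l.1, l.2).

Definition reduced (w : seq letter) : bool :=
  sorted (fun l m => m != letterV l) w.

Definition cons_letter (l : letter) (w : seq letter) : seq letter :=
  if w is m :: w' then if m == letterV l then w' else l :: w else [:: l].

Definition rcat (u v : seq letter) : seq letter := foldr cons_letter v u.

Definition rinv (u : seq letter) : seq letter := rev (map letterV u).

Lemma letterVK : involutive letterV.
Proof. by case=> b t; rewrite /letterV /= negbK. Qed.

Arguments letterV : simpl never.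

Lemma reduced_tail l w : reduced (l :: w) -> reduced w.
Proof. by case: w => //= m w /andP[]. Qed.

Lemma reduced_cons_letter l w : reduced w -> reduced (cons_letter l w).
Proof.
case: w => [|m w] //= rw; case: ifP => [_|/negbT nml].
  exact: (@reduced_tail m).
by rewrite /= nml.
Qed.

Lemma reduced_rcat u v : reduced v -> reduced (rcat u v).
Proof. by move=> rv; elim: u => //= l u; apply: reduced_cons_letter. Qed.

Lemma cons_letterK l w :
  reduced w -> cons_letter (letterV l) (cons_letter l w) = w.
Proof.
case: w => [|m w] /=; first by rewrite letterVK eqxx.
case: ifP => [/eqP -> | _] /=; last by rewrite letterVK eqxx.
by case: w => [|k w] //= /andP[/negbTE ->].
Qed.

Lemma cons_letterVK l w :
  reduced w -> cons_letter l (cons_letter (letterV l) w) = w.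
Proof. by move=> rw; rewrite -{1}[l]letterVK cons_letterK. Qed.

Lemma rcat_cons_letter l v w :
  reduced w -> rcat (cons_letter l v) w = cons_letter l (rcat v w).
Proof.
case: v => [|m v] //= rw; case: ifP => [/eqP ->|//].
by rewrite /= cons_letterVK // reduced_rcat.
Qed.

Lemma rcatA u v w : reduced w -> rcat u (rcat v w) = rcat (rcat u v) w.
Proof. by move=> rw; elim: u => //= l u ->; rewrite rcat_cons_letter. Qed.

Lemma rcat_reduced u : reduced u -> rcat u [::] = u.
Proof.
elim: u => //= l u IHu ru; rewrite IHu ?(reduced_tail ru) //.
by case: u ru {IHu} => //= m u /andP[/negbTE ->].
Qed.

Lemma rcat_rinv u v : reduced v -> rcat (rinv u) (rcat u v) = v.
Proof.
move=> rv; elim: u => //= l u IHu.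
rewrite /rinv /= rev_cons /rcat foldr_rcons -/(rcat _ _) -/(rcat u v).
by rewrite cons_letterK ?reduced_rcat.
Qed.

Lemma reduced_rinv u : reduced u -> reduced (rinv u).
Proof.
rewrite /reduced /rinv rev_sorted sorted_map; apply: sub_sorted => l m.
by rewrite /= letterVK eq_sym.
Qed.

Lemma rinvK u : rinv (rinv u) = u.
Proof.
by rewrite /rinv map_rev revK -map_comp -[RHS]map_id; apply/eq_map/letterVK.
Qed.

Record freegroup : predArgType :=
  FreeWord { fword :> seq letter; fwordP : reduced fword }.

HB.instance Definition _ := [isSub for fword].
HB.instance Definition _ := [Choice of freegroup by <:].

Definition free_one : freegroup := @FreeWord [::] isT.
Definition free_mul (u v : freegroup) : freegroup :=
  FreeWord (reduced_rcat u (fwordP v)).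
Definition free_inv (u : freegroup) : freegroup :=
  FreeWord (reduced_rinv (fwordP u)).

Lemma free_mulA : associative free_mul.
Proof. by move=> u v w; apply/val_inj/rcatA/fwordP. Qed.
Lemma free_mul1 : left_id free_one free_mul.
Proof. by move=> u; apply/val_inj. Qed.
Lemma free_1mul : right_id free_one free_mul.
Proof. by move=> u; apply/val_inj/rcat_reduced/fwordP. Qed.
Lemma free_mulV : left_inverse free_one free_inv free_mul.
Proof.
move=> u; apply/val_inj; rewrite /= -[X in rcat _ X](rcat_reduced (fwordP u)).
exact: rcat_rinv.
Qed.
Lemma free_Vmul : right_inverse free_one free_inv free_mul.
Proof.
move=> u; rewrite -[RHS](free_mulV (free_inv u)); congr free_mul.
by apply/val_inj; rewrite /= rinvK.
Qed.

HB.instance Definition _ :=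
  isGroup.Build freegroup free_mulA free_mul1 free_1mul free_mulV free_Vmul.

Definition free_gen (t : T) : freegroup := @FreeWord [:: (true, t)] isT.

Lemma free_ind (P : freegroup -> Prop) :
    P 1 -> (forall t, P (free_gen t)) ->
    (forall u v, P u -> P v -> P (u * v)) -> (forall u, P u -> P u^-1) ->
  forall u, P u.
Proof.
move=> P1 Pg PM PV [u ru].
elim: u ru => [|[b t] u IHu] ru.
  by have -> : FreeWord ru = 1 by exact: val_inj.
have Pl : P (@FreeWord [:: (b, t)] isT).
  case: b {ru}; first exact: Pg.
  have -> : @FreeWord [:: (false, t)] isT = (free_gen t)^-1 by exact: val_inj.
  exact: PV.
have -> : FreeWord ru = @FreeWord [:: (b, t)] isT * FreeWord (reduced_tail ru).
  apply: val_inj; rewrite -[LHS](rcat_reduced ru) /=.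
  by rewrite (rcat_reduced (reduced_tail ru)).
exact: PM.
Qed.

Section Lift.
Variables (H : groupType) (f : T -> H).

Definition letter_val (l : letter) : H := if l.1 then f l.2 else (f l.2)^-1.

Definition free_lift (u : freegroup) : H :=
  foldr (fun l h => letter_val l * h) 1 (fword u).

Lemma letter_valV l : letter_val (letterV l) = (letter_val l)^-1.
Proof. by case: l => [[] t]; rewrite /letter_val /= ?invgK. Qed.

Lemma free_liftM : {morph free_lift : u v / u * v}.
Proof.
move=> [u ru] [v rv]; rewrite /free_lift /= => {ru rv}.
have lc l w : foldr (fun l h => letter_val l * h) 1 (cons_letter l w) =
    letter_val l * foldr (fun l h => letter_val l * h) 1 w.
  case: w => [|m w] //=; case: eqP => [->|//].
  by rewrite letter_valV mulVKg.
by elim: u => [|l u IHu] /=; rewrite ?mul1g // lc IHu mulgA.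
Qed.

HB.instance Definition _ :=
  isUMagmaMorphism.Build freegroup H free_lift (erefl, free_liftM).

Lemma free_lift_gen t : free_lift (free_gen t) = f t.
Proof. exact: mulg1. Qed.

Lemma free_lift_uniq (g : UMagmaMorphism.type freegroup H) :
  (forall t, g (free_gen t) = f t) -> g =1 free_lift.
Proof.
move=> gE; apply: free_ind => [|t|u v|u].
- by rewrite !gmulf1.
- by rewrite gE free_lift_gen.
- by rewrite !gmulfM => -> ->.
- by rewrite !gmulfV => ->.
Qed.

End Lift.
End FreeGroup.

Section Subgroups.
Variable gT : groupType.
Implicit Types (A H N : set gT).

(* Left conjugation, [lconj x y] = y^x = x y x^-1; the library's [y ^ x] is   *)
(* x^-1 y x.                                                                  *)
Definition lconj (x y : gT) : gT := x * y * x^-1.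

Definition is_subgroup H : Prop :=
  H 1 /\ forall x y, H x -> H y -> H (x / y).

Definition is_normal N : Prop :=
  is_subgroup N /\ forall x y, N y -> N (lconj x y).

Definition gen A : set gT := smallest is_subgroup A.

Definition normal_closure A : set gT := smallest is_normal A.

Lemma gen_subgroup A : is_subgroup (gen A).
Proof.
split=> [H [[H1 _] _] //|x y Ax Ay H sAH].
by have [[_ HF] _] := sAH; apply: HF; [apply: Ax | apply: Ay].
Qed.

Lemma normal_closure_normal A : is_normal (normal_closure A).
Proof.
split; first split=> [N [[[N1 _] _] _] //|x y Ax Ay N sAN].
  by have [[[_ NF] _] _] := sAN; apply: NF; [apply: Ax | apply: Ay].
move=> x y Ay N sAN; have [[_ NJ] _] := sAN.
by apply: NJ; apply: Ay.
Qed.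

Lemma subgroupV H x : is_subgroup H -> H x -> H x^-1.
Proof. by case=> H1 HF Hx; rewrite -div1g; apply: HF. Qed.

Lemma subgroupM H x y : is_subgroup H -> H x -> H y -> H (x * y).
Proof.
by move=> sH Hx Hy; rewrite -[y]invgK; apply: sH.2 => //; apply: subgroupV.
Qed.

End Subgroups.

Record normal_sub (gT : groupType) :=
  NormalSub { nsub :> gT -> Prop; nsubP : is_normal nsub }.

Section QuotientGroup.
Variables (gT : groupType) (N : normal_sub gT).

Definition coset_eq (x y : gT) : bool := `[< N (x^-1 * y) >].

Lemma coset_eq_equiv : equiv_class_of coset_eq.
Proof.
have [sN _] := nsubP N; split=> [x|x y|y x z].
- by apply/asboolP; rewrite mulVg; case: sN.
- apply/asboolP/asboolP => /(subgroupV sN); by rewrite invgM invgK.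
- move=> /asboolP xy /asboolP yz; apply/asboolP.
  by have := subgroupM sN xy yz; rewrite mulgA mulgK.
Qed.

Canonical coset_equiv := EquivRelPack coset_eq_equiv.

Definition qgroup := {eq_quot coset_equiv}.
HB.instance Definition _ := Choice.on qgroup.
HB.instance Definition _ := EqQuotient.on qgroup.

Definition qproj (x : gT) : qgroup := \pi_qgroup x.

Lemma qproj_eq x y : qproj x = qproj y <-> N (x^-1 * y).
Proof.
rewrite /qproj; split=> [/eqmodP /asboolP //|Nxy].
by apply/eqmodP/asboolP.
Qed.

Lemma qproj_surj (c : qgroup) : exists x, c = qproj x.
Proof. by exists (repr c); rewrite /qproj reprK. Qed.

Definition q_one : qgroup := qproj 1.
Definition q_mul (c d : qgroup) : qgroup := qproj (repr c * repr d).
Definition q_inv (c : qgroup) : qgroup := qproj (repr c)^-1.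

Lemma repr_qproj x : N (x^-1 * repr (qproj x)).
Proof. by apply/qproj_eq; rewrite /qproj reprK. Qed.

Lemma normalJ x y : N y -> N (x^-1 * (y * x)).
Proof.
by case: (nsubP N) => _ NJ /(NJ x^-1); rewrite /lconj invgK -mulgA.
Qed.

Lemma q_mulE x y : q_mul (qproj x) (qproj y) = qproj (x * y).
Proof.
apply/esym/qproj_eq; have [sN _] := nsubP N.
rewrite invgM.
rewrite (_ : _ * _ = (y^-1 * ((x^-1 * repr (qproj x)) * y))
                     * (y^-1 * repr (qproj y))); last first.
  by rewrite -!mulgA mulVKg.
by apply: subgroupM; rewrite //; [apply: normalJ|]; apply: repr_qproj.
Qed.

Lemma q_invE x : q_inv (qproj x) = qproj x^-1.
Proof.
apply/qproj_eq; rewrite invgK; have [sN NJ] := nsubP N.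
have /(NJ x) := repr_qproj x; rewrite /lconj.
by rewrite mulVKg.
Qed.

Lemma q_mulA : associative q_mul.
Proof.
move=> a b c; have [x ->] := qproj_surj a; have [y ->] := qproj_surj b.
by have [z ->] := qproj_surj c; rewrite !q_mulE mulgA.
Qed.
Lemma q_mul1 : left_id q_one q_mul.
Proof. by move=> a; have [x ->] := qproj_surj a; rewrite q_mulE mul1g. Qed.
Lemma q_1mul : right_id q_one q_mul.
Proof. by move=> a; have [x ->] := qproj_surj a; rewrite q_mulE mulg1. Qed.
Lemma q_mulV : left_inverse q_one q_inv q_mul.
Proof. by move=> a; have [x ->] := qproj_surj a; rewrite q_invE q_mulE mulVg. Qed.
Lemma q_Vmul : right_inverse q_one q_inv q_mul.
Proof. by move=> a; have [x ->] := qproj_surj a; rewrite q_invE q_mulE mulgV. Qed.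

HB.instance Definition _ :=
  isGroup.Build qgroup q_mulA q_mul1 q_1mul q_mulV q_Vmul.

Lemma qprojM : {morph qproj : x y / x * y}.
Proof. by move=> x y; rewrite -q_mulE. Qed.

HB.instance Definition _ :=
  isUMagmaMorphism.Build gT qgroup qproj (erefl, qprojM).

Lemma qproj_eq1 x : qproj x = 1 <-> N x.
Proof.
rewrite -[1]/(qproj 1) qproj_eq mulg1.
have [sN _] := nsubP N.
by split=> /(subgroupV sN); rewrite ?invgK.
Qed.

End QuotientGroup.

(* <x, y>, (x, y) and (z)                                                     *)
Inductive surf_symbol (G : Type) : Type :=
| Comm of G & G
| Klein of G & G
| Square of G.

Section SymbolChoice.
Variable G : choiceType.

Definition symbol_code (s : surf_symbol G) : G * G + G * G + G :=
  match s with
  | Comm x y => inl (inl (x, y))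
  | Klein x y => inl (inr (x, y))
  | Square z => inr z
  end.

Definition symbol_decode (c : G * G + G * G + G) : surf_symbol G :=
  match c with
  | inl (inl (x, y)) => Comm x y
  | inl (inr (x, y)) => Klein x y
  | inr z => Square z
  end.

Lemma symbol_codeK : cancel symbol_code symbol_decode.
Proof. by case. Qed.

HB.instance Definition _ :=
  Choice.copy (surf_symbol G) (can_type symbol_codeK).

End SymbolChoice.

Section SchurMultiplier.
Variable G : groupType.
Implicit Types (x y z a b : G) (i j : int).

(* The library's [[~ x, y]] is x^-1 y^-1 x y, hence a separate definition.    *)
Definition comm x y : G := x * y * x^-1 * y^-1.
Definition klein x y : G := x * y * x^-1 * y.

Definition zexp x i : G :=
  match i with Posz n => x ^+ n | Negz n => x ^- n.+1 end.

Definition squares_subgroup : set G := gen [set x ^+ 2 | x in [set: G]].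

Definition surf_group := freegroup (surf_symbol G).
HB.instance Definition _ := Group.on surf_group.

Definition cm x y : surf_group := free_gen (Comm x y).
Definition kb x y : surf_group := free_gen (Klein x y).
Definition sq z : surf_group := free_gen (Square z).

Definition symbol_val (s : surf_symbol G) : G :=
  match s with
  | Comm x y => comm x y
  | Klein x y => klein x y
  | Square z => z ^+ 2
  end.

(* Its values lie in S(G), see [boundary_squares]; taking G as codomain does  *)
(* not change the kernel.                                                     *)
Definition boundary (w : surf_group) : G := free_lift symbol_val w.

Lemma boundaryM : {morph boundary : u v / u * v}.
Proof. exact: free_liftM. Qed.

HB.instance Definition _ :=
  isUMagmaMorphism.Build surf_group G boundary (erefl, boundaryM).

Lemma boundary_gen s : boundary (free_gen s) = symbol_val s.
Proof. exact: free_lift_gen. Qed.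

(* u ~ v; a superscript x acts on a symbol by [lconj x] on each of its        *)
(* entries.                                                                   *)
Inductive surf_rel : surf_group -> surf_group -> Prop :=
| SurfRel1 x i j :
    surf_rel (sq (zexp x i) * sq (zexp x j)) (sq (zexp x (i + j)%R))
| SurfRel2 x y :
    surf_rel (kb x (x * y)) (sq x * sq y)
| SurfRel3 x y :
    surf_rel (cm x y) (sq x * sq (x^-1 * y) * sq y^-1)
| SurfRel4 x y z :
    surf_rel (cm (x * y) z) (kb (lconj x y) (lconj x z) * kb x z^-1)
| SurfRel5 x y z :
    surf_rel (cm (lconj x y) (lconj x z)) (cm x (comm y z) * cm y z)
| SurfRel6 x y z :
    surf_rel (kb (lconj x y) (lconj x z)) (cm x (klein y z) * kb y z)
| SurfRel7 x y z :
    surf_rel (kb (lconj x y) (lconj x z))^-1 (kb x (klein y z)^-1 * kb y z)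
| SurfRel8 x y z :
    surf_rel (sq z * cm x y) (cm (lconj z y) (lconj z x) * sq (z * comm x y))
| SurfRel9 b (a0 b0 : G) :
    surf_rel (sq b * cm a0 b0)
             (cm (lconj (b ^+ 2) a0) (lconj (b ^+ 2) b0) * sq b)
| SurfRel10 a (a0 b0 : G) :
    surf_rel (cm a0 b0 * sq a)
             (sq a * cm (lconj (a ^- 2) a0) (lconj (a ^- 2) b0)).

Definition surf_relators : set surf_group :=
  [set w | exists u v, surf_rel u v /\ w = u * v^-1].

Definition surf_N : normal_sub surf_group :=
  NormalSub (normal_closure_normal surf_relators).

Definition surf_ker : pred surf_group := [pred w | boundary w == 1].

Lemma surf_ker_closed : group_closed surf_ker.
Proof.
split=> [|u v]; rewrite !inE; first by rewrite gmulf1.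
by rewrite gmulfF /= => /eqP -> /eqP ->; rewrite divg1.
Qed.

Record surf_K : predArgType := SurfK { kword :> surf_group; _ : surf_ker kword }.
HB.instance Definition _ := [isSub for kword].
HB.instance Definition _ := [Choice of surf_K by <:].
HB.instance Definition _ :=
  SubChoice_isSubGroup.Build surf_group surf_ker surf_K surf_ker_closed.

Lemma surf_NK_normal : is_normal [set k : surf_K | surf_N (val k)].
Proof.
have [[N1 NF] NJ] := nsubP surf_N.
split; first split=> [|x y Nx Ny] /=.
- exact: N1.
- exact: NF.
- by move=> x y /(NJ (val x)).
Qed.

(* N' as a subgroup of K'; all of N' lies in K' by [surf_N_sub].              *)
Definition surf_NK : normal_sub surf_K := NormalSub surf_NK_normal.

Definition unoriented_schur := qgroup surf_NK.
HB.instance Definition _ := Group.on unoriented_schur.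

(* K' maps to the centre of (G,G)/N', so the multiplier is abelian.           *)
Definition sqN z : qgroup surf_N := qproj surf_N (sq z).
Definition cmN x y : qgroup surf_N := qproj surf_N (cm x y).
Definition kbN x y : qgroup surf_N := qproj surf_N (kb x y).

Lemma surf_rel_qproj u v : surf_rel u v -> qproj surf_N u = qproj surf_N v.
Proof.
move=> uv; apply/eqP; rewrite -divg_eq1; apply/eqP.
rewrite -gmulfF; apply/qproj_eq1.
by move=> N [_]; apply; exists u, v.
Qed.

Lemma schur_sqX x i j : sqN (zexp x (i + j)%R) = sqN (zexp x i) * sqN (zexp x j).
Proof. by rewrite /sqN -(surf_rel_qproj (SurfRel1 _ _ _)) qprojM. Qed.

Lemma schur_sq1 : sqN 1 = 1.
Proof. by apply: (mulgI (sqN 1)); rewrite mulg1 -(schur_sqX 1 0 0). Qed.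

Lemma schur_sqV x : sqN x^-1 = (sqN x)^-1.
Proof.
apply: (mulgI (sqN x)); rewrite mulgV -schur_sq1.
exact/esym/(schur_sqX x 1 (-1)).
Qed.

Lemma schur_sq2 x : sqN (x ^+ 2) = sqN x * sqN x.
Proof. exact: (schur_sqX x 1 1). Qed.

Lemma schur_kbE x y : kbN x y = sqN x * sqN (x^-1 * y).
Proof.
rewrite -[y in LHS](mulVKg x) /kbN (surf_rel_qproj (SurfRel2 _ _)).
by rewrite qprojM.
Qed.

Lemma schur_cmE x y : cmN x y = sqN x * sqN (x^-1 * y) * (sqN y)^-1.
Proof.
by rewrite -schur_sqV /cmN (surf_rel_qproj (SurfRel3 _ _)) !qprojM.
Qed.

Lemma schur_cmV x y : (cmN x y)^-1 = cmN y x.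
Proof.
rewrite !schur_cmE !invgM invgK -(schur_sqV (x^-1 * y)) invgM invgK.
by rewrite mulgA.
Qed.

Lemma schur_cmxx x : cmN x x = 1.
Proof. by rewrite schur_cmE mulVg schur_sq1 mulg1 mulgV. Qed.

Lemma schur_sqJ x z : sqN (lconj x z) = cmN x (z ^+ 2) * sqN z.
Proof.
have := surf_rel_qproj (SurfRel6 x 1 z); rewrite qprojM.
rewrite -/(kbN _ _) -/(kbN 1 z) -/(cmN _ _) !schur_kbE.
rewrite /klein /lconj mulg1 mulgV invg1 !mul1g mulg1 schur_sq1 !mul1g -expg2.
by [].
Qed.

Lemma lconjM x y z : lconj x (y * z) = lconj x y * lconj x z.
Proof. by rewrite /lconj -!mulgA mulKg. Qed.

Lemma lconjV x y : lconj x y^-1 = (lconj x y)^-1.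
Proof. by rewrite /lconj !invgM invgK mulgA. Qed.

Lemma lconj_lconj x y z : lconj (x * y) z = lconj x (lconj y z).
Proof. by rewrite /lconj invgM !mulgA. Qed.

Lemma schur_cmMl x y z :
  cmN (x * y) z = cmN (lconj x y) (lconj x z) * cmN x z.
Proof.
have E x' y' z' : cmN (x' * y') z' =
    cmN (lconj x' y') (lconj x' z') * (sqN (lconj x' z') * kbN x' z'^-1).
  rewrite /cmN (surf_rel_qproj (SurfRel4 _ _ _)) qprojM -/(kbN _ _) -/(kbN x' _).
  by rewrite -/(cmN _ _) [kbN (lconj _ _) _]schur_kbE schur_cmE !mulgA mulgVK.
rewrite E; congr (_ * _).
have := E x 1 z; rewrite mulg1 => ->.
by rewrite /lconj mulg1 mulgV schur_cmE invg1 schur_sq1 !mul1g mulgV mul1g.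
Qed.

Lemma schur_cmMr x y z :
  cmN x (y * z) = cmN x y * cmN (lconj y x) (lconj y z).
Proof.
by rewrite -schur_cmV schur_cmMl invgM !schur_cmV.
Qed.

Lemma schur_sq_cm b x y :
  sqN b * cmN x y = cmN (lconj (b ^+ 2) x) (lconj (b ^+ 2) y) * sqN b.
Proof. by rewrite /sqN /cmN -!qprojM (surf_rel_qproj (SurfRel9 _ _ _)). Qed.

Lemma qproj_boundary_ind (P : qgroup surf_N -> G -> Prop) :
    P 1 1 -> (forall c d g h, P c g -> P d h -> P (c * d) (g * h)) ->
    (forall c g, P c g -> P c^-1 g^-1) -> (forall b, P (sqN b) (b ^+ 2)) ->
  forall w, P (qproj surf_N w) (boundary w).
Proof.
move=> P1 PM PV Pq; apply: free_ind => [|s|u v Pu Pv|u Pu].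
- by rewrite !gmulf1.
- have bE x y : comm x y = x ^+ 2 * (x^-1 * y) ^+ 2 * (y ^+ 2)^-1.
    by rewrite /comm !expg2 invgM !mulgA mulgK mulgK.
  have kE x y : klein x y = x ^+ 2 * (x^-1 * y) ^+ 2.
    by rewrite /klein !expg2 !mulgA mulgK.
  rewrite boundary_gen; case: s => [x y|x y|z] /=; last exact: Pq.
  + by rewrite -/(cm x y) -/(cmN x y) schur_cmE bE; apply: (PM); [exact: (PM)|exact: PV].
  + by rewrite -/(kb x y) -/(kbN x y) schur_kbE kE; apply: PM.
- by rewrite qprojM boundaryM; apply: PM.
- by rewrite !gmulfV; apply: PV.
Qed.

Lemma schur_cmJ w x y :
  qproj surf_N w * cmN x y =
  cmN (lconj (boundary w) x) (lconj (boundary w) y) * qproj surf_N w.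
Proof.
pose P c g := forall x y, c * cmN x y = cmN (lconj g x) (lconj g y) * c.
apply: (@qproj_boundary_ind P) => {w x y} [x y|c d g h cg dh x y|c g cg x y|b x y].
- by rewrite /lconj !mul1g invg1 !mulg1.
- by rewrite -mulgA dh mulgA cg !lconj_lconj mulgA.
- apply: (mulgI c); rewrite mulVKg mulgA cg mulgK.
  by rewrite -!lconj_lconj mulgV /lconj !mul1g invg1 !mulg1.
- exact: schur_sq_cm.
Qed.

Lemma schur_sq_sq b z : sqN b * sqN z = sqN (lconj (b ^+ 2) z) * sqN b.
Proof.
have sqM x y : sqN x * sqN y = cmN x (x * y) * sqN (x * y).
  by rewrite schur_cmE mulKg mulgVK.
have lxx x : lconj x x = x by rewrite /lconj mulgK.
have lJ g x y : lconj (lconj g x) (lconj g y) = lconj (g * x) y.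
  by rewrite /lconj !invgM invgK !mulgA !mulgVK.
pose J g := cmN (lconj g b) (lconj g z).
have Jb : cmN b (b * z) = J b by rewrite schur_cmMr schur_cmxx mul1g lxx /J lxx.
have Jz : cmN (z * b) z = J z by rewrite schur_cmMl schur_cmxx mulg1.
have JM g : cmN (lconj g b) (lconj g (z * b)) = J g.
  by rewrite lconjM schur_cmMr schur_cmxx mulg1.
have J1 : cmN b (z * b) = cmN b z by rewrite schur_cmMr schur_cmxx mulg1.
have JX g : cmN (lconj g b) (lconj g (z * z)) = J g * J (g * z).
  by rewrite lconjM schur_cmMr !lJ.
have JC : cmN b z * J (z * b) = J (b * z) * cmN b z.
  rewrite [LHS]schur_cmJ boundary_gen -!lconj_lconj /= /comm.
  by rewrite !mulgA mulgVK mulgVK.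
have H1 : sqN (z * b) = J z * (sqN z * sqN b).
  by rewrite sqM -Jz -schur_cmV mulKg.
have H2 : cmN b ((z * b) ^+ 2) = cmN b z * J (z * b).
  by rewrite expg2 schur_cmMr J1 JM.
have H3 : cmN (b ^+ 2) (z ^+ 2) = J b * J (b * z) * (cmN b z * J z).
  by rewrite !expg2 schur_cmMl JX schur_cmMr.
have bz : b * z = lconj b (z * b) by rewrite /lconj !mulgA mulgK.
rewrite sqM Jb [in sqN _]bz !schur_sqJ H1 H2 H3 JC.
by rewrite !mulgA.
Qed.

Lemma schur_central w u : boundary w = 1 ->
  commute (qproj surf_N w) (qproj surf_N u).
Proof.
move=> w1; apply: (@qproj_boundary_ind (fun c _ => commute (qproj surf_N w) c)).
- exact: commute1.
- by move=> c d _ _; apply: commuteM.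
- by move=> c _; apply: commuteV.
move=> b; rewrite /commute.
have := @qproj_boundary_ind (fun c g => forall z, c * sqN z = sqN (lconj g z) * c).
move=> /(_ _ _ _ schur_sq_sq w b) ->.
- by rewrite w1 /lconj mul1g invg1 mulg1.
- by move=> z; rewrite /lconj !mul1g invg1 !mulg1.
- by move=> c d g h cg dh z; rewrite -mulgA dh mulgA cg lconj_lconj mulgA.
- move=> c g cg z; apply: (mulgI c); rewrite mulVKg mulgA cg mulgK.
  by rewrite -lconj_lconj mulgV /lconj mul1g invg1 mulg1.
Qed.

Lemma unoriented_schurC (c d : unoriented_schur) : c * d = d * c.
Proof.
have [k ->] := qproj_surj c; have [l ->] := qproj_surj d.
rewrite -[LHS]qprojM -[RHS]qprojM; apply/qproj_eq.
apply/(@qproj_eq _ surf_N (val (k * l)) (val (l * k))).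
rewrite [LHS]qprojM [RHS]qprojM; apply: schur_central.
exact/eqP/(valP k).
Qed.

Definition bogomolov_classes : set unoriented_schur :=
  [set c | exists2 k : surf_K, c = qproj surf_NK k &
     [\/ exists x y, comm x y = 1 /\ val k = cm x y,
         exists x y, klein x y = 1 /\ val k = kb x y |
         exists z, z ^+ 2 = 1 /\ val k = sq z]].

Lemma gen_classes_normal : is_normal (gen bogomolov_classes).
Proof.
split=> [|x y]; first exact: gen_subgroup.
by rewrite /lconj unoriented_schurC mulKg.
Qed.

Definition bogomolov := qgroup (NormalSub gen_classes_normal).
HB.instance Definition _ := Group.on bogomolov.

Lemma zexpD x i j : zexp x (i + j)%R = zexp x i * zexp x j.
Proof.
have S k : zexp x (k + 1)%R = zexp x k * x.
  case: k => [n|[|n]].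
  - by rewrite -PoszD addn1 /= expgSr.
  - by rewrite /= mulVg.
  - have -> : (Negz n.+1 + 1 = Negz n)%R.
      by rewrite !NegzE -[in LHS]addn1 PoszD GRing.opprD GRing.addrNK.
    by rewrite /= (expgS x n.+1) invgM mulgVK.
elim/int_ind: j => [|n IHn|n IHn]; first by rewrite GRing.addr0 mulg1.
- by rewrite -addn1 PoszD GRing.addrA !S IHn mulgA.
- apply: (mulIg x); rewrite -S -mulgA -S.
  by rewrite -GRing.addrA -addn1 PoszD GRing.opprD GRing.addrNK.
Qed.

Lemma surf_N_sub w : surf_N w -> boundary w = 1.
Proof.
pose ker : set surf_group := [set w | boundary w = 1].
move=> /(_ ker); apply; split; first split; first split.
- exact: gmulf1.
- by move=> u v /= u1 v1; rewrite /ker /= gmulfF /= u1 v1 divg1.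
- move=> u v /= v1; rewrite /ker /= /lconj !boundaryM v1 mulg1 -boundaryM.
  by rewrite mulgV gmulf1.
have bV u : boundary u^-1 = (boundary u)^-1 by exact: gmulfV.
move=> _ [u [v [uv ->]]]; rewrite /ker /= boundaryM bV.
apply/eqP; rewrite divg_eq1; apply/eqP.
case: uv => *; rewrite ?bV ?boundaryM ?boundary_gen /= /klein /comm /lconj.
1: rewrite !expg2 zexpD !mulgA; congr (_ * _); rewrite -!mulgA.
1: by congr (_ * _); rewrite -!zexpD GRing.addrC.
all: rewrite ?expg2 ?invgM ?invgK ?mulgA.
all: by rewrite ?(mulgK, mulgVK, mulgV, mul1g).
Qed.

Lemma boundary_squares w : squares_subgroup (boundary w).
Proof.
have sS := gen_subgroup [set x ^+ 2 | x in [set: G]].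
have S2 x : squares_subgroup (x ^+ 2) by apply: sub_gen_smallest; exists x.
apply: (@qproj_boundary_ind (fun _ g => squares_subgroup g)) => //.
- exact: sS.1.
- by move=> c d g h; apply: subgroupM.
- by move=> _ g; apply: subgroupV.
Qed.

End SchurMultiplier.

(* Main.v *)
(* Killing the torus, Klein bottle and projective plane classes in (G,G)/N'   *)
(* gives a central extension E of S(G) with kernel B_0(G;Z_2), generated by   *)
(* the classes s(z) of (z). In E one has [u,v] = <du,dv>, so commuting        *)
(* elements of S(G) lift to commuting elements.                               *)
(* If an abelian subgroup A contains all non-involutions (abelian and         *)
(* dihedral groups), then E = s(A), s is a homomorphism on A, and s(a) = 1    *)
(* as soon as a^2 = 1.                                                        *)
(* If G is a permutation group containing all 3-cycles (symmetric and         *)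
(* alternating groups), then E is generated by the lifts s(c^-1) of the       *)
(* 3-cycles c. Since commuting pairs lift, these lifts multiply in E as the   *)
(* 3-cycles do in a copy of A_4, whenever a product of two 3-cycles on four   *)
(* points is again a 3-cycle. These relations suffice to write a product of   *)
(* lifts of 3-cycles on X as at most one lift of a 3-cycle moving n followed  *)
(* by lifts of 3-cycles on X \ n; a product with trivial boundary has no such *)
(* first factor, and induction on X shows that it is 1.                       *)

From HB Require Import structures.
Require Import Defs.
From mathcomp Require Import all_boot all_algebra all_fingroup all_solvable.
From mathcomp Require classical_sets.

Set Implicit Arguments.
Unset Strict Implicit.
Unset Printing Implicit Defensive.

Local Open Scope group_scope.

(** Everything reduces to injectivity of the boundary on E ([bogomolov_eq1]). The two tools are
    [bog_ext_comm], by which a commutator in E depends only on boundaries, and [sqB_sqB], which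
    splits lifts of 3-cycles off [sqB z]. For permutation groups the crux is the A_4 relation
    [lift3_mul]; [supported_remove] turns it into a normal form for words, whose leading factor is
    visible in the boundary. *)

(** * The extension E and its commutators *)

Section BogomolovExtension.
Variable G : groupType.
Implicit Types (x y z b : G) (w : surf_group G).

(** The kernel of K' -> B_0(G;Z_2), viewed inside (G,G) so that the whole free group can be divided
    by it. *)
Definition bog_trivial w : Prop :=
  exists2 k : surf_K G, val k = w &
    gen (@bogomolov_classes G) (qproj (surf_NK G) k).

Lemma surf_N_bog_trivial w : surf_N G w -> bog_trivial w.
Proof.
move=> Nw; have kw : surf_ker w by apply/eqP/surf_N_sub.
exists (SurfK kw) => //.
have -> : qproj (surf_NK G) (SurfK kw) = 1 by apply/qproj_eq1.
exact: (gen_subgroup _).1.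
Qed.

(** K'/N' is central in (G,G)/N' ([schur_central]), so conjugation by any element of (G,G) fixes
    these classes. *)
Lemma bog_trivial_normal : is_normal bog_trivial.
Proof.
have sg := gen_subgroup (@bogomolov_classes G).
split; first split=> [|_ _ [k <- gk] [l <- gl]].
- exists 1; first by rewrite gmulf1.
  by rewrite gmulf1; exact: sg.1.
- exists (k * l^-1); first by rewrite gmulfM gmulfV.
  by rewrite gmulfM gmulfV; apply: sg.2.
move=> v _ [k <- gk].
have k1 : boundary (val k) = 1 by apply/eqP; exact: (valP k).
have kv : surf_ker (lconj v (val k)).
  by rewrite /surf_ker /= /lconj !boundaryM k1 mulg1 -boundaryM mulgV gmulf1.
exists (SurfK kv) => //.
suff -> : qproj (surf_NK G) (SurfK kv) = qproj (surf_NK G) k by [].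
apply/qproj_eq; apply/(@qproj_eq _ (surf_N G) (lconj v (val k)) (val k)).
rewrite /lconj !qprojM -(schur_central v k1).
by rewrite -!qprojM mulgK.
Qed.

(* The central extension of S(G) by B_0(G;Z_2). *)
Definition bog_ext := qgroup (NormalSub bog_trivial_normal).
HB.instance Definition _ := Group.on bog_ext.
Definition bproj w : bog_ext := qproj (NormalSub bog_trivial_normal) w.

Lemma bprojM : {morph bproj : w w' / w * w'}.
Proof. exact: qprojM. Qed.

Lemma bproj1 : bproj 1 = 1. Proof. by []. Qed.

Lemma bprojV w : bproj w^-1 = (bproj w)^-1.
Proof. by apply: (mulgI (bproj w)); rewrite -bprojM !mulgV. Qed.

Lemma bproj_surj (u : bog_ext) : exists w, u = bproj w.
Proof. exact: qproj_surj. Qed.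

Lemma qproj_bproj w w' :
  qproj (surf_N G) w = qproj (surf_N G) w' -> bproj w = bproj w'.
Proof. by move/qproj_eq/surf_N_bog_trivial => ?; apply/qproj_eq. Qed.

Lemma bog_trivial_boundary w : bog_trivial w -> boundary w = 1.
Proof. by case=> k <- _; apply/eqP; exact: (valP k). Qed.

Definition bdry (u : bog_ext) : G :=
  boundary (generic_quotient.repr u : surf_group G).

Lemma bdryE w : bdry (bproj w) = boundary w.
Proof.
have := repr_qproj (NormalSub bog_trivial_normal) w.
move/bog_trivial_boundary; rewrite boundaryM gmulfV => /mulg1_eq.
by rewrite invgK.
Qed.

Lemma bdryM : {morph bdry : u v / u * v}.
Proof.
move=> u v; have [w ->] := bproj_surj u; have [w' ->] := bproj_surj v.
by rewrite -bprojM !bdryE boundaryM.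
Qed.

Lemma bdry1 : bdry 1 = 1.
Proof. by rewrite -bproj1 bdryE gmulf1. Qed.

Lemma bdryV u : bdry u^-1 = (bdry u)^-1.
Proof. by apply: (mulgI (bdry u)); rewrite -bdryM !mulgV bdry1. Qed.

Definition sqB z := bproj (sq z).

Lemma bdry_sq z : bdry (sqB z) = z ^+ 2.
Proof. by rewrite bdryE boundary_gen. Qed.

Lemma bproj_cm x y : bproj (cm x y) = sqB x * sqB (x^-1 * y) * (sqB y)^-1.
Proof.
rewrite /sqB -bprojV -!bprojM; apply: qproj_bproj.
by rewrite -/(cmN x y) schur_cmE !qprojM gmulfV.
Qed.

Lemma bproj_kb x y : bproj (kb x y) = sqB x * sqB (x^-1 * y).
Proof.
rewrite /sqB -!bprojM; apply: qproj_bproj.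
by rewrite -/(kbN x y) schur_kbE !qprojM.
Qed.

Lemma bog_ext_ind (P : bog_ext -> Prop) :
    P 1 -> (forall u v, P u -> P v -> P (u * v)) -> (forall u, P u -> P u^-1) ->
    (forall z, P (sqB z)) ->
  forall u, P u.
Proof.
move=> P1 PM PV Ps u; have [w ->] := bproj_surj u; move: w.
apply: (@free_ind _ (fun w => P (bproj w))) => [//|s|v w Pv Pw|v Pv].
- case: s => [x y|x y|z]; last exact: Ps.
  + by rewrite bproj_cm; apply: (PM); [apply: PM | apply: PV].
  + by rewrite bproj_kb; apply: PM.
- by rewrite bprojM; apply: PM.
- by rewrite bprojV; apply: PV.
Qed.

Lemma bog_ext_cm1 x y : comm x y = 1 -> bproj (cm x y) = 1.
Proof.
move=> xy1; apply/qproj_eq1 => /=.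
have kw : surf_ker (cm x y) by rewrite /surf_ker /= boundary_gen; apply/eqP.
exists (SurfK kw) => //.
apply: classical_sets.sub_gen_smallest; exists (SurfK kw) => //.
by constructor 1; exists x, y.
Qed.

Lemma sqB_eq1 z : z ^+ 2 = 1 -> sqB z = 1.
Proof.
move=> z1; apply/qproj_eq1 => /=.
have kw : surf_ker (sq z) by rewrite /surf_ker /= boundary_gen; apply/eqP.
exists (SurfK kw) => //.
apply: classical_sets.sub_gen_smallest; exists (SurfK kw) => //.
by constructor 3; exists z.
Qed.

Lemma sqB1 : sqB 1 = 1. Proof. by rewrite sqB_eq1 ?expg1n. Qed.

(** The torus class [cm x (x * y)] dies in E, and [SurfRel3] expands it as
    [sqB x * sqB y * (sqB (x * y))^-1]. *)
Lemma sqBM x y : commute x y -> sqB (x * y) = sqB x * sqB y.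
Proof.
move=> xy; have : comm x (x * y) = 1 by rewrite /comm {1}xy mulgA mulgK mulgV.
move/bog_ext_cm1; rewrite bproj_cm mulKg => /mulg1_eq/(congr1 (@invg _)).
by rewrite !invgK.
Qed.

Lemma sqBV x : sqB x^-1 = (sqB x)^-1.
Proof.
apply: (mulgI (sqB x)); rewrite mulgV -sqBM ?mulgV ?sqB1 //.
exact/commuteV/commute_refl.
Qed.

Lemma bog_ext_conj u z : u * sqB z * u^-1 = sqB (lconj (bdry u) z).
Proof.
elim/bog_ext_ind: u z => [|u v Pu Pv|u Pu|b] z.
- by rewrite bdry1 /lconj !mul1g !invg1 !mulg1.
- by rewrite bdryM lconj_lconj -Pu -Pv invgM !mulgA.
- have e : lconj (bdry u) (lconj (bdry u)^-1 z) = z.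
    by rewrite -lconj_lconj mulgV /lconj mul1g invg1 mulg1.
  by rewrite bdryV -{1}e -Pu !mulgA mulVg mul1g invgK mulgVK.
have -> : sqB b * sqB z = sqB (lconj (b ^+ 2) z) * sqB b.
  by rewrite -!bprojM; apply: qproj_bproj; rewrite !qprojM; apply: schur_sq_sq.
by rewrite mulgK bdry_sq.
Qed.

Definition cmB x y := bproj (cm x y).

Lemma cmBMr x y z : cmB x (y * z) = cmB x y * cmB (lconj y x) (lconj y z).
Proof.
rewrite -bprojM; apply: qproj_bproj; rewrite qprojM; exact: schur_cmMr.
Qed.

Lemma sqBJ x z : sqB (lconj x z) = cmB x (z ^+ 2) * sqB z.
Proof.
by rewrite -bprojM; apply: qproj_bproj; rewrite qprojM; apply: schur_sqJ.
Qed.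

Lemma cmBJ u x y :
  u * cmB x y * u^-1 = cmB (lconj (bdry u) x) (lconj (bdry u) y).
Proof.
have [w ->] := bproj_surj u; rewrite bdryE.
apply: (mulIg (bproj w)); rewrite mulgVK -!bprojM; apply: qproj_bproj.
by rewrite !qprojM; apply: schur_cmJ.
Qed.

Lemma cmBx1 x : cmB x 1 = 1.
Proof. by apply: bog_ext_cm1; rewrite /comm invg1 !mulg1 mulgV. Qed.

(** Both sides obey the same product rule in [v]. For [v = sqB b], [bog_ext_conj] turns the
    commutator into [sqB (lconj (bdry u) b) * (sqB b)^-1], which [sqBJ] identifies. *)
Lemma bog_ext_comm u v : comm u v = cmB (bdry u) (bdry v).
Proof.
elim/bog_ext_ind: v u => [|v w Pv Pw|v Pv|b] u.
- by rewrite bdry1 cmBx1 /comm invg1 !mulg1 mulgV.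
- rewrite bdryM cmBMr -cmBJ -Pv -Pw /comm invgM.
  by rewrite !mulgA mulgVK mulgVK.
- have uv : v * comm u v^-1 * v^-1 = (comm u v)^-1.
    by rewrite /comm !invgM !invgK !mulgA mulgK.
  apply: (mulgI v); apply: (mulIg v^-1); rewrite uv cmBJ Pv bdryV.
  by apply: mulg1_eq; rewrite -cmBMr mulgV cmBx1.
apply: (mulIg (sqB b)); rewrite bdry_sq -sqBJ /comm mulgVK.
exact: bog_ext_conj.
Qed.

(* This is where the torus classes have to be killed. *)
Lemma bog_ext_commute u v : commute (bdry u) (bdry v) -> commute u v.
Proof.
move=> uv; have /bog_ext_cm1 : comm (bdry u) (bdry v) = 1.
  by rewrite /comm uv mulgK mulgV.
rewrite -/(cmB _ _) -bog_ext_comm /comm -mulgA -invgM => /mulg1_eq/invg_inj.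
by [].
Qed.

(** Two evaluations of [cmB z (b ^+ 2)] are compared, by [sqBJ] and by [SurfRel3]. *)
Lemma sqB_sqB z b :
  sqB z * sqB (z^-1 * b ^+ 2) = sqB (lconj z b) * sqB b.
Proof.
rewrite sqBJ /cmB bproj_cm (sqBM (commute_refl b)) invgM.
by rewrite !mulgA !mulgVK.
Qed.

Lemma bogomolov_eq1 :
  (forall u : bog_ext, bdry u = 1 -> u = 1) -> forall c : bogomolov G, c = 1.
Proof.
move=> inj c; have [d ->] := qproj_surj c; have [k ->] := qproj_surj d.
apply/qproj_eq1 => /=.
have /inj/qproj_eq1 [l /val_inj -> //] : bdry (bproj (val k)) = 1.
by rewrite bdryE; apply/eqP; exact: (valP k).
Qed.

Lemma bogomolov_abelian_involutions (A : G -> Prop) :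
    A 1 -> (forall x y, A x -> A y -> A (x * y)) -> (forall x, A x -> A x^-1) ->
    (forall x y, A x -> A y -> commute x y) ->
    (forall x, A x \/ x ^+ 2 = 1) ->
  forall c : bogomolov G, c = 1.
Proof.
move=> A1 AM AV AC AG; apply: bogomolov_eq1 => u.
have [a Aa ->] : exists2 a, A a & u = sqB a.
  elim/bog_ext_ind: u => [|_ _ [a Aa ->] [b Ab ->]|_ [a Aa ->]|z].
  - by exists 1; rewrite ?sqB1.
  - by exists (a * b); [exact: AM | rewrite sqBM //; exact: AC].
  - by exists a^-1; [exact: AV | rewrite sqBV].
  - by have [Az|/sqB_eq1 ->] := AG z; [exists z | exists 1; rewrite ?sqB1].
by rewrite bdry_sq; apply: sqB_eq1.
Qed.

End BogomolovExtension.

(** * 3-cycles and the relations between their lifts *)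

Definition cycle3 (T : eqType) (a b c : T) : T -> T :=
  [fun x => x with a |-> b, b |-> c, c |-> a].

Definition swap22 (T : eqType) (a b x y : T) : T -> T :=
  [fun z => z with a |-> b, b |-> a, x |-> y, y |-> x].

Ltac decide_eqs :=
  rewrite /cycle3 /swap22 /=;
  repeat match goal with
  | |- context [?a == ?a] => rewrite eqxx /=
  | H : is_true (?a != ?b) |- context [?a == ?b] => rewrite (negbTE H) /=
  | H : is_true (?b != ?a) |- context [?a == ?b] =>
      rewrite [a == b]eq_sym (negbTE H) /=
  end.

Ltac split_uniq U :=
  move: (U); rewrite /= ?inE ?negb_or ?andbT;
  repeat match goal with
  | |- is_true (_ && _) -> _ => case/andP
  | |- is_true (_ != _) -> _ => let H := fresh "ne" in move=> H
  | |- _ -> is_true (_ && _) -> _ => let H := fresh "ne" in move=> H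
  end.

Ltac split_pt x a :=
  let e := fresh "e" in
  case: (eqVneq x a) => [e|?]; [rewrite ?e; solve [by decide_eqs] | ].

Section ThreeCycles.
Variables (G : groupType) (T : finType) (act : G -> T -> T).
Hypothesis act1 : forall x, act 1 x = x.
Hypothesis actM : forall g h x, act (g * h) x = act g (act h x).
Hypothesis act_faithful : forall g h, act g =1 act h -> g = h.
(** Left unspecified on triples with repeated points. Identities between 3-cycles become pointwise
    checks through [act_faithful]. *)
Variable cyc : T -> T -> T -> G.
Hypothesis cycE :
  forall a b c, uniq [:: a; b; c] -> act (cyc a b c) =1 cycle3 a b c.

Local Notation d := (@bdry G).

Lemma actK g : cancel (act g) (act g^-1).
Proof. by move=> x; rewrite -actM mulVg act1. Qed.

Lemma act_inj g : injective (act g).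
Proof. exact: can_inj (actK g). Qed.

Lemma uniq3_rot (a b c : T) : uniq [:: a; b; c] -> uniq [:: b; c; a].
Proof. by move=> U; rewrite -(rot_uniq 2). Qed.

Lemma uniq3_swap (a b c : T) : uniq [:: a; b; c] -> uniq [:: a; c; b].
Proof. by move=> U; split_uniq U; decide_eqs. Qed.

Lemma uniq3_act g (a b c : T) :
  uniq [:: a; b; c] -> uniq [:: act g a; act g b; act g c].
Proof. by rewrite -(map_inj_uniq (@act_inj g)). Qed.

Lemma cyc_rot a b c : uniq [:: a; b; c] -> cyc b c a = cyc a b c.
Proof.
move=> U; apply: act_faithful => x; rewrite !cycE ?(uniq3_rot U) //.
by split_uniq U; split_pt x a; split_pt x b; split_pt x c; decide_eqs.
Qed.

Lemma cyc_sq a b c : uniq [:: a; b; c] -> cyc a b c ^+ 2 = cyc a c b.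
Proof.
move=> U; apply: act_faithful => x; rewrite expg2 actM !cycE ?(uniq3_swap U) //.
by split_uniq U; split_pt x a; split_pt x b; split_pt x c; decide_eqs.
Qed.

Lemma cyc_inv a b c : uniq [:: a; b; c] -> (cyc a b c)^-1 = cyc a c b.
Proof.
move=> U; apply: mulg1_eq; apply: act_faithful => x.
rewrite actM act1 !cycE ?(uniq3_swap U) //.
by split_uniq U; split_pt x a; split_pt x b; split_pt x c; decide_eqs.
Qed.

Lemma lconj_cyc g a b c : uniq [:: a; b; c] ->
  lconj g (cyc a b c) = cyc (act g a) (act g b) (act g c).
Proof.
move=> U; apply: (mulIg g); rewrite /lconj mulgVK; apply: act_faithful => x.
rewrite !actM !cycE ?uniq3_act // /cycle3 /= !(inj_eq (@act_inj g)).
by case: ifP => // _; case: ifP => // _; case: ifP.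
Qed.

(* The inverse makes lift3 a b c a lift of [cyc a b c] = [cyc a c b ^+ 2]. *)
Definition lift3 a b c : bog_ext G := sqB (cyc a c b).

Lemma bdry_lift3 a b c : uniq [:: a; b; c] -> d (lift3 a b c) = cyc a b c.
Proof. by move=> U; rewrite bdry_sq cyc_sq // uniq3_swap. Qed.

Lemma lift3_rot a b c : uniq [:: a; b; c] -> lift3 b c a = lift3 a b c.
Proof.
move=> U; congr sqB; rewrite (cyc_rot (uniq3_rot (uniq3_swap U))).
exact: cyc_rot (uniq3_swap U).
Qed.

Lemma lift3_sq a b c : uniq [:: a; b; c] ->
  lift3 a b c * lift3 a b c = lift3 a c b.
Proof.
move=> U; rewrite /lift3 -(sqBM (commute_refl _)) -expg2 cyc_sq //.
exact: uniq3_swap.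
Qed.

Lemma lift3_inv a b c : uniq [:: a; b; c] -> (lift3 a b c)^-1 = lift3 a c b.
Proof. by move=> U; rewrite /lift3 -sqBV cyc_inv // uniq3_swap. Qed.

Lemma lift3_conj u a b c : uniq [:: a; b; c] ->
  u * lift3 a b c * u^-1 = lift3 (act (d u) a) (act (d u) b) (act (d u) c).
Proof. by move=> U; rewrite bog_ext_conj lconj_cyc // uniq3_swap. Qed.

(* Conjugating a lift D1 of (p q)(x y) by the lift of (p q x) gives lifts D3  *)
(* and D2 of the other two double transpositions, which commute and have the  *)
(* same central square.                                                       *)
Lemma lift3_mul p q x y : uniq [:: p; q; x; y] ->
  lift3 p q x * lift3 q p y = lift3 p y x.
Proof.
move=> U.
have U1 : uniq [:: p; q; x] by split_uniq U; decide_eqs.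
have U2 : uniq [:: p; x; q] by exact: uniq3_swap.
have U3 : uniq [:: p; x; y] by split_uniq U; decide_eqs.
set tau := lift3 p q x; pose D1 := lift3 p x q * lift3 p x y.
pose D3 := tau * D1 * tau^-1; pose D2 := tau * D3 * tau^-1.
have D1E : act (d D1) =1 swap22 p q x y.
  move=> z; rewrite bdryM actM !bdry_lift3 // !cycE //; split_uniq U.
  by split_pt z p; split_pt z q; split_pt z x; split_pt z y; decide_eqs.
have D3E : act (d D3) =1 swap22 p y q x.
  move=> z; rewrite !bdryM -bdryM bdryV !actM D1E bdry_lift3 // cyc_inv //.
  rewrite !cycE //; split_uniq U.
  by split_pt z p; split_pt z q; split_pt z x; split_pt z y; decide_eqs.
have D2E : act (d D2) =1 swap22 p x q y.
  move=> z; rewrite !(bdryM _ tau^-1) bdryM bdryV !actM D3E bdry_lift3 //.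
  rewrite cyc_inv // !cycE //; split_uniq U.
  by split_pt z p; split_pt z q; split_pt z x; split_pt z y; decide_eqs.
have tE : lift3 q p y = D1 * tau * D1^-1.
  by rewrite lift3_conj // !D1E; split_uniq U; decide_eqs.
have tE' : lift3 p y x = D2 * tau^-1 * D2^-1.
  rewrite lift3_inv // lift3_conj // !D2E; split_uniq U; decide_eqs.
  by apply: lift3_rot; exact: uniq3_rot (uniq3_rot (uniq3_swap U3)).
have D23 : commute D2 D3.
  apply: bog_ext_commute; apply: act_faithful => z.
  rewrite !actM !(D2E, D3E); split_uniq U.
  by split_pt z p; split_pt z q; split_pt z x; split_pt z y; decide_eqs.
have D33 : D2 * D2 = D3 * D3.
  (* [D3 * D3] has trivial boundary, so it commutes with all of E. *)
  have c3 : commute tau (D3 * D3).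
    apply: bog_ext_commute; rewrite (bdryM D3).
    suff -> : d D3 * d D3 = 1 by exact: commute1.
    apply: act_faithful => z; rewrite actM act1 !D3E; split_uniq U.
    by split_pt z p; split_pt z q; split_pt z x; split_pt z y; decide_eqs.
  by rewrite -[RHS](mulgK tau) -c3 /D2 !mulgA mulgVK.
have tau3 : tau * tau = tau^-1 by rewrite lift3_sq // lift3_inv.
have -> : lift3 p q x * lift3 q p y = D3 * D2^-1 * tau^-1.
  by rewrite tE -/tau -tau3 /D2 /D3 !invgM !invgK !mulgA !(mulgVK, mulgK).
have -> : lift3 p y x = D2 * D3^-1 * tau^-1.
  by rewrite tE' {2}/D2 !invgM !invgK !mulgA mulgVK.
(* What remains is [D3 * D2^-1 = D2 * D3^-1]: two commuting elements with equal squares. *)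
congr (_ * _); apply: (mulIg D2); rewrite mulgVK -mulgA.
by rewrite -(commuteV D23) mulgA D33 mulgK.
Qed.

(** * Normal form of words in lifts of 3-cycles *)

Inductive supported (X : {set T}) : bog_ext G -> Prop :=
| Supported1 : supported X 1
| SupportedM a b c u : uniq [:: a; b; c] -> [/\ a \in X, b \in X & c \in X] ->
    supported X u -> supported X (lift3 a b c * u).

Lemma supported_bdry X u n : supported X u -> n \notin X -> act (d u) n = n.
Proof.
move=> Xu nX; elim: Xu => [|a b c v U [aX bX cX] _ IH].
  by rewrite bdry1 act1.
rewrite bdryM actM IH bdry_lift3 // cycE //.
have [na nb nc] : [/\ n != a, n != b & n != c].
  by split; apply: contraNneq nX => ->.
by decide_eqs.
Qed.

(** [lift3_mul] solved for its second factor: the third point [b] is traded for a prescribed [k], at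
    the cost of a lift that does not move [n]. *)
Lemma lift3_split n m k b : uniq [:: n; m; k] -> uniq [:: n; m; b] ->
  b = k \/ uniq [:: m; b; k] /\ lift3 n m b = lift3 n m k * lift3 m b k.
Proof.
move=> U V; case: (eqVneq b k) => [->|bk]; first by left.
right; have W : uniq [:: m; n; k; b].
  by split_uniq U; split_uniq V; decide_eqs.
split; first by split_uniq W; decide_eqs.
have V' : uniq [:: m; n; k] by split_uniq W; decide_eqs.
by rewrite -(lift3_mul W) mulgA -(lift3_rot V') -(lift3_inv U) mulgV mul1g.
Qed.

(** Each new letter is pushed into the normal form of the rest of the word. A letter fixing [n]
    passes the leading factor by conjugation; a letter moving [n] merges with it, once [lift3_split]
    has made the two share enough points. *)
Lemma supported_remove (X : {set T}) n u : supported X u ->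
  supported (X :\ n) u \/
  exists a b v, [/\ uniq [:: n; a; b], a \in X /\ b \in X,
    supported (X :\ n) v & u = lift3 n a b * v].
Proof.
elim=> [|x y z {}u U [xX yX zX] _]; first by left; constructor.
have [|] := boolP (n \in [:: x; y; z]); last first.
  rewrite !inE !negb_or => /and3P[nx ny nz].
  have tX v : supported (X :\ n) v -> supported (X :\ n) (lift3 x y z * v).
    by constructor; rewrite // !inE xX yX zX ![_ == n]eq_sym nx ny nz.
  case=> [Xu|[a [b [v [V [aX bX] Xv ->]]]]]; first by left; apply: tX.
  right; exists (cycle3 x y z a), (cycle3 x y z b), (lift3 x y z * v).
  have e : act (d (lift3 x y z)) n = n.
    by rewrite bdry_lift3 // cycE //; decide_eqs.
  have cX c : c \in X -> cycle3 x y z c \in X.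
    by move=> cX; rewrite /cycle3 /=; do 3 case: ifP => _ //.
  split; [|by split; apply: cX|exact: tX|].
  - by have := uniq3_act (d (lift3 x y z)) V; rewrite e bdry_lift3 // !cycE.
  - have := lift3_conj (lift3 x y z) V; rewrite e bdry_lift3 // !cycE // => <-.
    by rewrite !mulgA mulgVK.
move=> nxyz.
have [m [k [{}U mX kX ->]]] : exists m k,
    [/\ uniq [:: n; m; k], m \in X, k \in X & lift3 x y z = lift3 n m k].
  move: nxyz; rewrite !inE => /or3P[] /eqP ->.
  - by exists y, z.
  - by exists z, x; split=> //; [exact: uniq3_rot | exact/esym/lift3_rot].
  - have V : uniq [:: z; x; y] by exact/uniq3_rot/uniq3_rot.
    by exists x, y; split=> //; exact: lift3_rot.
have tX p q r v : uniq [:: p; q; r] -> n \notin [:: p; q; r] ->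
    p \in X -> q \in X -> r \in X ->
    supported (X :\ n) v -> supported (X :\ n) (lift3 p q r * v).
  rewrite !inE !negb_or => W /and3P[np nq nr] pX qX rX.
  by constructor; rewrite // !inE pX qX rX ![_ == n]eq_sym np nq nr.
case=> [Xu|[a [b [v [V [aX bX] Xv ->]]]]].
  by right; exists m, k, u.
(* For [a = m] the two factors merge into the square of (n m k), which is (n k m). *)
case: (eqVneq a m) => [am|ma].
  subst a; right; have [->|[W ->]] := lift3_split U V.
    by exists k, m, v; rewrite mulgA (lift3_sq U) (uniq3_swap U).
  exists k, m, (lift3 m b k * v); split; rewrite ?(uniq3_swap U) //; last first.
    by rewrite !mulgA (lift3_sq U).
  by apply: tX => //; split_uniq U; split_uniq V; decide_eqs.
(* For [a = k] the factors moving [n] cancel. *)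
case: (eqVneq a k) => [ak|ka].
  subst a; left; have [->|[W ->]] := lift3_split (uniq3_swap U) V.
    by rewrite -(lift3_inv U) mulVKg.
  rewrite -(lift3_inv U) !mulgA mulgV mul1g.
  by apply: tX => //; split_uniq U; split_uniq V; decide_eqs.
right; have W : uniq [:: n; m; k; a].
  by split_uniq U; split_uniq V; decide_eqs.
have Um : uniq [:: n; a; m] by split_uniq W; decide_eqs.
have Uk : uniq [:: n; a; k] by split_uniq W; decide_eqs.
have e : lift3 n m k * lift3 n a m = lift3 n a k.
  by rewrite (lift3_rot (uniq3_rot (uniq3_rot Um))) lift3_mul.
have [->|[W' ->]] := lift3_split Um V; first by exists a, k, v; rewrite mulgA e.
exists a, k, (lift3 a b m * v); split; rewrite ?mulgA ?e //.
by apply: tX => //; split_uniq U; split_uniq V; decide_eqs.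
Qed.

Lemma supported_bdry_eq1 (X : {set T}) u : supported X u -> d u = 1 -> u = 1.
Proof.
have [k] := ubnP #|X|; elim: k X u => // k IH X u Xk Xu du.
have [X0|[n nX]] := set_0Vmem X.
  by case: Xu => // a b c v _ []; rewrite X0 inE.
have [Xu'|[a [b [v [U _ Xv uE]]]]] := supported_remove n Xu.
  by apply: IH Xu' du; rewrite (cardsD1 n X) nX in Xk.
have vn : act (d v) n = n by apply: supported_bdry Xv _; rewrite !inE eqxx.
(* The leading factor would send [n], which [d v] fixes, to [a], distinct from [n]. *)
move/(congr1 (act^~ n)): du.
rewrite act1 uE bdryM actM vn bdry_lift3 // cycE //.
by split_uniq U; decide_eqs => an; rewrite an eqxx in ne.
Qed.

Lemma supported_mul u v :
  supported [set: T] u -> supported [set: T] v -> supported [set: T] (u * v).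
Proof.
move=> Tu Tv; elim: Tu => [|a b c w U _ _ IH]; first by rewrite mul1g.
by rewrite -mulgA; apply: SupportedM; rewrite ?inE.
Qed.

Lemma supported_lift3 a b c :
  uniq [:: a; b; c] -> supported [set: T] (lift3 a b c).
Proof.
move=> U; rewrite -[lift3 a b c]mulg1.
by apply: SupportedM; rewrite ?inE //; constructor.
Qed.

Lemma supported_inv u : supported [set: T] u -> supported [set: T] u^-1.
Proof.
elim=> [|a b c w U _ _ IH]; first by rewrite invg1; constructor.
rewrite invgM lift3_inv //; apply: supported_mul => //.
exact/supported_lift3/uniq3_swap.
Qed.

(* If z^2 moves a, then composing z with the inverse of (a, z a, z^2 a) fixes *)
(* a and creates no new moved point; if z^2 = 1, then (z) is trivial.         *)
Lemma supported_sqB z : supported [set: T] (sqB z).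
Proof.
have [k] := ubnP #|[set x | act z x != x]|; elim: k z => // k IH z zk.
have [/forallP zz|] := boolP [forall x, act z (act z x) == x].
  rewrite sqB_eq1; first by constructor.
  by apply: act_faithful => x; rewrite expg2 actM act1; apply/eqP.
case/forallPn => a; set b := act z a; set c := act z b => ca.
have ba : b != a by apply: contraNneq ca => ba; rewrite /c ba -/b ba.
have cb : c != b by rewrite (inj_eq (@act_inj z)).
have U : uniq [:: a; b; c] by rewrite /= !inE; decide_eqs.
(* As [cyc a c b] squares to [cyc a b c], this writes [sqB z] as [lift3 (act z a) (act z b) (act z
   c) * lift3 a b c * sqB (cyc a c b * z)]. *)
have := sqB_sqB z (cyc a c b).
have U' := uniq3_swap U; rewrite cyc_sq // lconj_cyc //.
move/(canRL (mulgK _)) => ->; apply: supported_mul.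
  apply: supported_mul; apply: supported_lift3 => //.
  by have := uniq3_act z U.
rewrite -sqBV invgM invgK cyc_inv //; apply: IH.
rewrite ltnS in zk; apply: leq_trans zk.
apply: proper_card; apply/properP; split.
  apply/subsetP => x; rewrite !inE; apply: contraNN => /eqP zx.
  have [xa xb] : x != a /\ x != b.
    by split; apply: contra_eqN zx => /eqP ->.
  have xc : x != c.
    by apply: contraNneq xb => xc; apply/eqP/(@act_inj z); rewrite zx.
  by rewrite actM zx cycE //; decide_eqs.
exists a; rewrite !inE ?ba //.
by rewrite actM -/b cycE //; decide_eqs.
Qed.

Lemma bogomolov_three_cycles : forall c : bogomolov G, c = 1.
Proof.
apply: bogomolov_eq1 => u; apply: (@supported_bdry_eq1 setT).
elim/bog_ext_ind: u => [|u v|u|z].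
- by constructor.
- exact: supported_mul.
- exact: supported_inv.
- exact: supported_sqB.
Qed.

End ThreeCycles.

(** * The four families of groups *)

Lemma bogomolov_perm (G : finGroupType) (T : finType)
    (f : {morphism [set: G] >-> {perm T}}) :
  'injm f -> 'Alt_T \subset f @* [set: G] -> forall c : bogomolov G, c = 1.
Proof.
move=> injf sAf.
(* Permutations compose from left to right, so inverses give a left action. *)
pose act (g : G) (x : T) := f g^-1 x.
pose p3 (a b c : T) : {perm T} := tperm a b * tperm a c.
have p3E a b c : uniq [:: a; b; c] -> p3 a b c =1 cycle3 a b c.
  move=> U x; rewrite /p3 permM !permE /=; split_uniq U.
  by split_pt x a; split_pt x b; split_pt x c; decide_eqs.
have p3f a b c : uniq [:: a; b; c] -> p3 a b c \in f @* [set: G].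
  move=> U; apply: (subsetP sAf); rewrite Alt_even odd_permM !odd_tperm.
  by split_uniq U; decide_eqs.
(* The inverse cancels the one in [act], so that [cyc a b c] acts as [p3 a b c]. *)
pose cyc a b c := (invm injf (p3 a b c))^-1.
apply: (@bogomolov_three_cycles _ T act _ _ _ cyc).
- by move=> x; rewrite /act invg1 morph1 perm1.
- by move=> g h x; rewrite /act invgM morphM ?inE // permM.
- move=> g h gh; apply: invg_inj; apply: (injmP injf); rewrite ?inE //.
  exact/permP.
- move=> a b c U x; rewrite /act /cyc invgK invmK ?p3f //; exact: p3E.
Qed.

Theorem theorem20 (G : finGroupType)
  (hG : [\/ abelian [set: G],
            exists2 n : nat, (1 < n)%N & [set: G] \isog 'D_(n.*2),
            exists n : nat, [set: G] \isog 'Sym_('I_n) |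
            exists n : nat, [set: G] \isog 'Alt_('I_n)]) :
  forall c : bogomolov G, c = 1.
Proof.
case: hG => [abG|[n n1 /isog_hom]|[n /isogP[f injf fG]]|[n /isogP[f injf fG]]].
- apply: (@bogomolov_abelian_involutions _ (fun _ => True)) => //; last by left.
  by move=> x y _ _; apply: (centsP abG); rewrite inE.
- rewrite Grp_dihedral // => /existsP[[x y]] /=.
  rewrite !xpair_eqE => /and4P[/eqP xyG _ /eqP y2 /eqP xy].
  apply: (@bogomolov_abelian_involutions _ (fun g => g \in <[x]>)) => //.
  + exact: groupM.
  + by move=> g; rewrite groupV.
  + by move=> g h gx hx; apply: (centsP (cycle_abelian x)).
  have nxy : <[y]> \subset 'N(<[x]>).
    by rewrite norms_cycle xy groupV cycle_id.
  move=> g; have : g \in <[x]> <*> <[y]> by rewrite xyG inE.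
  rewrite norm_joinEr // => /mulsgP[_ _ /cycleP[i ->] /cycleP[j ->] ->].
  have yV : y^-1 = y by apply: mulg1_eq; rewrite -expg2.
  (* Only the parity of [j] matters: even gives a rotation in [<[x]>], odd a reflection, hence an
     involution. *)
  rewrite -(odd_double_half j) expgD -mul2n expgM y2 expg1n mulg1.
  case: (odd j); last by left; rewrite mulg1 mem_cycle.
  by right; rewrite expg1 expg2 -mulgA -{1}yV -conjgE conjXg xy expVgn mulgV.
- by apply: (bogomolov_perm injf); rewrite fG subsetT.
- by apply: (bogomolov_perm injf); rewrite fG.
Qed.
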